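(* Let $R$ be the root system of type $A_{n-1}$ and let $(\gamma,J)$ be a placed shape such that $\gamma$ is dominant and integral (i.e. $\gamma=(\gamma_1,\dots,\gamma_n)$ with $\gamma_1\le\dots\le\gamma_n$ and $\gamma_i\in\mathbb{Z}$) and such that $J$ satisfies: if $\beta\in J$, $\alpha\in Z(\gamma)$ and $\beta-\alpha\in R^+$ then $\beta-\alpha\in J$ (so that $(\gamma,J)$ determines a placed configuration of boxes). Then the configuration of boxes associated to $(\gamma,J)$ is a (classical) placed skew shape if and only if $(\gamma,J)$ is a generalized placed skew shape.
   Context: Type $A_{n-1}$: $\{\varepsilon_1,\dots,\varepsilon_n\}$ is an orthonormal basis of $\mathbb{R}^n$, $R=\{\varepsilon_j-\varepsilon_i\mid i\ne j\}$, $R^+=\{\varepsilon_j-\varepsilon_i\mid i<j\}$, simple roots $\alpha_i=\varepsilon_i-\varepsilon_{i-1}$ ($2\le i\le n$), $W=S_n$ acting by $w\varepsilon_i=\varepsilon_{w(i)}$. $R(w)=\{\alpha\in R^+\mid w\alpha\in -R^+\}$. For dominant $\gamma$: $Z(\gamma)=\{\alpha\in R^+\mid\langle\gamma,\alpha\rangle=0\}$, $P(\gamma)=\{\alpha\in R\mid\langle\gamma,\alpha\rangle=1\}$. A placed shape is a pair $(\gamma,J)$ with $\gamma$ dominant and $J\subseteq P(\gamma)$; $\mathcal{F}^{(\gamma,J)}=\{w\in W\mid R(w)\cap Z(\gamma)=\emptyset,\ R(w)\cap P(\gamma)=J\}$. Generalized placed skew shape: for a set $K$ of simple roots let $R_K$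 be the root subsystem generated by $K$ and $W_K$ its Weyl group; regard $\gamma\in\mathbb{R}^n$ as the function $\alpha\mapsto\langle\gamma,\alpha\rangle$ on $R$ and let $\gamma|_K$ be its restriction to $R_K$; $\gamma|_K$ is regular if $\langle\gamma,\alpha\rangle\ne0$ for all $\alpha\in R_K$. In general type, $(\gamma,J)$ is a placed skew shape if for all $w\in\mathcal{F}^{(\gamma,J)}$: (a) for each simple root $\alpha_i$, $w\gamma|_{\{\alpha_i\}}$ is regular; and (b) for each pair of simple roots $\{\alpha_i,\alpha_j\}$, either $w\gamma|_{\{\alpha_i,\alpha_j\}}$ is regular, or it is in the $W_{\{\alpha_i,\alpha_j\}}$-orbit of the function $\tau$ with $\langle\tau,\alpha_i\rangle=1$, $\langle\tau,\alpha_j\rangle=0$, where $\alpha_i$ is long and $\alpha_j$ is short. In type $A$ all roots have the same length, so the second alternative in (b) does not occur. Placed configuration of $(\gamma,J)$: boxes $\mathrm{box}_1,\dots,\mathrm{box}_n$ on infinite graph paper whose diagonals run northwest to southeast and are indexed by $\mathbb{Z}$ increasing from southwest to northeast; $\mathrm{box}_i$ is on diagonal $\gamma_i$; boxes on the same diagonal have indices increasing from northwest to southeast; if $\varepsilon_j-\varepsilon_i\in J$ then $\mathrm{box}_j$ is northwest (strictly north, weakly west) of $\mathrm{box}_i$, and if $\varepsilon_j-\varepsilon_i\in P(\gamma)\setminus J$ then $\mathrm{box}_j$ is southeast (weakly south, strictly east) of $\mathrm{box}_i$. Boxes are allowed to slide along their diagonals as long as these relative positions are preserved. The configuration is a (classical)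 placed skew shape if it can be realized by a skew shape $\lambda/\mu$ (the boxes of a partition $\lambda$ not in a partition $\mu\subseteq\lambda$) placed on the graph paper (the box in row $r$, column $c$, rows numbered downward, lying on the diagonal with index $c-r+\text{const}$), i.e. if there is a placed $\lambda/\mu$ whose boxes, numbered diagonal by diagonal from southwest to northeast and from northwest to southeast within each diagonal, have diagonal indices $(\gamma_1,\dots,\gamma_n)$ and satisfy $J=\{\varepsilon_j-\varepsilon_i\mid j>i,\ \gamma_j=\gamma_i+1,\ \mathrm{box}_j\text{ is northwest of }\mathrm{box}_i\}$. *)

(* Defs.v *)
From HB Require Import structures.
From mathcomp Require Import all_boot all_order all_algebra fingroup perm.
From mathcomp Require Import boolp classical_sets functions reals.
Set Implicit Arguments.
Unset Strict Implicit.
Unset Printing Implicit Defensive.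
Import Order.TTheory GRing.Theory Num.Theory.
Local Open Scope classical_set_scope.
Local Open Scope ring_scope.

(* Indices are shifted by one: 1, ..., n become 0, ..., n-1 in 'I_n. *)

Section TypeA.
Variables (R : realType) (n : nat).
Local Notation V := 'rV[R]_n.
Implicit Types (gamma v a b : V) (w : 'S_n) (J K : set V).

Definition dot (u v : V) : R := \sum_(i < n) u 0 i * v 0 i.

Definition eps (i : 'I_n) : V := delta_mx 0 i.

Definition roots : set V :=
  [set a | exists i j : 'I_n, i != j /\ a = eps j - eps i].

Definition pos_roots : set V :=
  [set a | exists i j : 'I_n, (i < j)%N /\ a = eps j - eps i].

Definition simple_roots : set V :=
  [set a | exists i j : 'I_n, j = i.+1 :> nat /\ a = eps j - eps i].

Definition act w v : V := \row_i v 0 ((w^-1)%g i).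

Lemma act_eps w (i : 'I_n) : act w (eps i) = eps (w i).
Proof.
apply/rowP => k; rewrite !mxE !eqxx /=; congr (_%:R); congr nat_of_bool.
by apply/eqP/eqP => [<-|->]; rewrite ?permKV ?permK.
Qed.

Definition inversions w : set V :=
  [set a | pos_roots a /\ pos_roots (- act w a)].

Definition dominant gamma : Prop :=
  forall i j : 'I_n, (i <= j)%N -> gamma 0 i <= gamma 0 j.

Definition integral gamma : Prop := forall i, gamma 0 i \is a Num.int.

Definition Zset gamma : set V := [set a | pos_roots a /\ dot gamma a = 0].

Definition Pset gamma : set V := [set a | roots a /\ dot gamma a = 1].

Definition placed_shape gamma J : Prop := dominant gamma /\ J `<=` Pset gamma.

Definition tableaux gamma J : set 'S_n :=
  [set w | inversions w `&` Zset gamma = set0 /\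
           inversions w `&` Pset gamma = J].

Definition reflection a v : V := v - (2 * dot v a / dot a a) *: a.

Definition root_subsystem K : set V :=
  smallest (fun A => forall a b, A a -> A b -> A (reflection a b)) K.

(* Reflections are involutions, so closure under composition is enough. *)
Definition weyl_group K : set (V -> V) :=
  smallest (fun G => G idfun /\ forall f g, G f -> G g -> G (f \o g))
           [set reflection a | a in K].

Definition regular_on K gamma : Prop :=
  forall a, root_subsystem K a -> dot gamma a != 0.

(* gamma, restricted to the subsystem of {a, b}, is in the orbit of the
   function tau such that <tau, a> = 1 and <tau, b> = 0, a being long and
   b short. *)
Definition in_tau_orbit a b gamma : Prop :=
  dot b b < dot a a /\
  exists tau u, [/\ dot tau a = 1, dot tau b = 0, weyl_group [set a; b] u &
    forall c, root_subsystem [set a; b] c -> dot gamma c = dot (u tau) c].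

Definition generalized_placed_skew_shape gamma J : Prop :=
  forall w, tableaux gamma J w ->
    (forall a, simple_roots a -> regular_on [set a] (act w gamma)) /\
    (forall a b, simple_roots a -> simple_roots b -> a != b ->
       [\/ regular_on [set a; b] (act w gamma),
           in_tau_orbit a b (act w gamma) |
           in_tau_orbit b a (act w gamma)]).

End TypeA.

(* A box of the infinite graph paper is a pair (row, column); rows are numbered
   downward and columns rightward. *)
Definition row_of (b : int * int) : int := b.1.
Definition col_of (b : int * int) : int := b.2.
Definition diag_of (b : int * int) : int := col_of b - row_of b.

Definition northwest (b c : int * int) : Prop :=
  row_of b < row_of c /\ col_of b <= col_of c.

Definition southeast (b c : int * int) : Prop :=
  row_of c <= row_of b /\ col_of c < col_of b.

(* Since boxes may slide along their diagonals, (gamma, J) determines the family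
   of all placements satisfying these constraints. *)
Definition placed_configuration (R : realType) (n : nat) (gamma : 'rV[R]_n)
    (J : set 'rV[R]_n) (box : 'I_n -> int * int) : Prop :=
  [/\ forall i, (diag_of (box i))%:~R = gamma 0 i,
      forall i j : 'I_n, (i < j)%N -> diag_of (box i) = diag_of (box j) ->
        row_of (box i) < row_of (box j),
      forall i j : 'I_n, J (eps R j - eps R i) -> northwest (box j) (box i) &
      forall i j : 'I_n, (Pset gamma `\` J) (eps R j - eps R i) ->
        southeast (box j) (box i)].

Definition is_partition (la : seq nat) : bool := sorted geq la && (0%N \notin la).

Definition partition_le (mu la : seq nat) : Prop :=
  forall r, (nth 0%N mu r <= nth 0%N la r)%N.

(* The diagram of la / mu, translated so that its northwest corner is o. *)
Definition placed_skew_diagram (la mu : seq nat) (o : int * int) :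
    set (int * int) :=
  [set b | exists r c : nat, (nth 0%N mu r <= c < nth 0%N la r)%N /\
                             b = (o.1 + r%:Z, o.2 + c%:Z)].

Definition classical_placed_skew_shape (R : realType) (n : nat)
    (gamma : 'rV[R]_n) (J : set 'rV[R]_n) : Prop :=
  exists (la mu : seq nat) (o : int * int) (box : 'I_n -> int * int),
    [/\ is_partition la, is_partition mu, partition_le mu la,
        set_bij [set: 'I_n] (placed_skew_diagram la mu o) box &
        placed_configuration gamma J box].

(* Main.v *)
Require Import Defs.
From HB Require Import structures.
From mathcomp Require Import all_boot all_order all_algebra fingroup perm.
From mathcomp Require Import boolp classical_sets functions reals.
From mathcomp Require Import zify ring lra.
Set Implicit Arguments.
Unset Strict Implicit.
Unset Printing Implicit Defensive.
Import Order.TTheory GRing.Theory Num.Theory.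
Local Open Scope classical_set_scope.
Local Open Scope ring_scope.

(* Read [w] in the tableaux of [(gamma, J)] as a filling: it is a linear
   extension of the relation "box [x] is northwest of box [y]", which is a total
   order on every two adjacent diagonals. The generalized condition says that in
   every such filling two boxes of the same diagonal have entries differing by
   at least 3. In a skew shape this holds because the boxes east and south of
   the first one have entries in between. Conversely, if two boxes of a diagonal
   have no box of the next diagonal between them, then a minimal such pair has at
   most one box between them in the generated partial order, and some filling
   gives them entries differing by at most 2. Hence adjacent diagonals
   interlace, so that they can be packed into a convex set of boxes, and the
   finite convex sets are exactly the placed skew diagrams. *)

(** * Roots and reflections in type A *)

Section Roots.
Variables (R : realType) (n : nat).
Implicit Types (v gamma : 'rV[R]_n) (w : 'S_n) (i j k p q : 'I_n).

Lemma dotBr v (a b : 'rV[R]_n) : dot v (a - b) = dot v a - dot v b.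
Proof.
by rewrite /dot -sumrB; apply: eq_bigr => i _; rewrite !mxE mulrBr.
Qed.

Lemma dot_eps v i : dot v (eps R i) = v 0 i.
Proof.
rewrite /dot (bigD1 i) //= big1 => [|k ki]; rewrite !mxE eqxx /=.
  by rewrite eqxx mulr1 addr0.
by rewrite (negPf ki) mulr0.
Qed.

Lemma dot_root v i j : dot v (eps R j - eps R i) = v 0 j - v 0 i.
Proof. by rewrite dotBr !dot_eps. Qed.

Lemma root_inj i j p q : i != j ->
  eps R j - eps R i = eps R q - eps R p -> i = p /\ j = q.
Proof.
move=> ij /rowP E; have := E i; have := E j.
rewrite !mxE !eqxx /= (eq_sym j i) (negPf ij).
have natb (b : bool) : b%:R = (if b then 1 else 0) :> R by case: b.
rewrite !natb.
have [->|_] := eqVneq i p; have [jq|_] := eqVneq j q;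
  rewrite -?jq ?(negPf ij) //; do 2?case: (_ == _);
  move=> /= h1 h2; exfalso; clear -h1 h2; lra.
Qed.

Lemma pos_rootP i j : i != j -> pos_roots (eps R j - eps R i) <-> (i < j)%N.
Proof.
move=> ij; split=> [[p [q [pq]]]|lt_ij]; last by exists i, j.
by case/(root_inj ij) => -> ->.
Qed.

Lemma act_root w i j :
  act w (eps R j - eps R i) = eps R (w j) - eps R (w i).
Proof. by rewrite -!act_eps; apply/rowP => k; rewrite !mxE. Qed.

Lemma act_coord w v i : act w v 0 (w i) = v 0 i.
Proof. by rewrite mxE permK. Qed.

Lemma inversionP w i j :
  inversions w (eps R j - eps R i) <-> (i < j)%N /\ (w j < w i)%N.
Proof.
have [<-|ij] := eqVneq i j.
  rewrite ltnn; split=> [[[p [q [pq E]]] _]|[] //]; move: E; rewrite subrr => /esym/eqP.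
  rewrite subr_eq0 => /eqP E.
  have qp : q != p by rewrite neq_ltn pq orbT.
  have [] := @root_inj p q q p; rewrite 1?eq_sym ?E ?subrr //.
  by move=> pq'; rewrite pq' ltnn in pq.
have wij : w j != w i by rewrite (inj_eq perm_inj) eq_sym.
by rewrite /inversions /= act_root opprB pos_rootP // pos_rootP.
Qed.

Lemma dot_root_norm i j : i != j ->
  dot (eps R j - eps R i) (eps R j - eps R i) = 2.
Proof.
move=> ij; rewrite dot_root !mxE !eqxx /= (eq_sym j i) (negPf ij).
by rewrite subr0 sub0r opprK.
Qed.

Lemma reflection_root i j v : i != j ->
  reflection (eps R j - eps R i) v = act (tperm i j) v.
Proof.
move=> ij; rewrite /reflection dot_root_norm // dot_root.
have -> : 2 * (v 0 j - v 0 i) / 2 = v 0 j - v 0 i by field.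
apply/rowP => k; rewrite !mxE eqxx /= tpermV.
have [->|ki] := eqVneq k i.
  by rewrite tpermL (negPf ij) /= sub0r mulrN1 opprK addrCA subrr addr0.
have [->|kj] := eqVneq k j.
  by rewrite tpermR /=; ring.
by rewrite tpermD 1?eq_sym //= subr0 mulr0 subr0.
Qed.

(* Reflecting in [eps j - eps i] transposes [i] and [j], so the roots joining
   two indices of the same class of a partition are closed under reflections. *)
Lemma root_subsystem_class (c : 'I_n -> nat) (K : set 'rV[R]_n) a :
  (forall b, K b -> exists i j, [/\ i != j, c i = c j & b = eps R j - eps R i]) ->
  root_subsystem K a ->
  exists i j, [/\ i != j, c i = c j & a = eps R j - eps R i].
Proof.
move=> hK /(_ [set b | exists i j, [/\ i != j, c i = c j & b = eps R j - eps R i]]).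
apply; split=> // _ _ [i [j [ij cij ->]]] [p [q [pq cpq ->]]].
exists (tperm i j p), (tperm i j q); split.
- by rewrite (inj_eq perm_inj).
- have ct k : c (tperm i j k) = c k by case: tpermP => [->|->|//].
  by rewrite !ct.
- by rewrite reflection_root // act_root.
Qed.

(** All roots have squared length 2, whereas the exceptional orbit needs two different lengths. *)
Lemma simple_root_tau_orbitF (a b : 'rV[R]_n) gamma :
  simple_roots a -> simple_roots b -> ~ in_tau_orbit a b gamma.
Proof.
move=> [i [j [ij ->]]] [p [q [pq ->]]] [].
have neq (k l : 'I_n) : l = k.+1 :> nat -> k != l.
  by move=> lk; rewrite -val_eqE /= lk neq_ltn ltnSn.
by rewrite !dot_root_norm ?ltxx //; apply: neq.
Qed.

(* Two adjacent simple roots generate a subsystem of type A_2, whence the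
   distance 2; commuting pairs contribute nothing new. *)
Lemma regular_simple_pairsP gamma :
  ((forall a, simple_roots a -> regular_on [set a] gamma) /\
   (forall a b, simple_roots a -> simple_roots b -> a != b ->
      [\/ regular_on [set a; b] gamma, in_tau_orbit a b gamma |
          in_tau_orbit b a gamma])) <->
  (forall p q, (p < q <= p + 2)%N -> gamma 0 p != gamma 0 q).
Proof.
split=> [[h1 h2] p q /andP[pq qp]|h].
  have [qp1|qp2] : q = p.+1 :> nat \/ q = p.+2 :> nat by lia.
    have sa : simple_roots (eps R q - eps R p) by exists p, q.
    have := h1 _ sa (eps R q - eps R p) (fun A hA => hA.2 _ erefl).
    by rewrite dot_root subr_eq0 eq_sym.
  have ltn1 : (p.+1 < n)%N by have := ltn_ord q; lia.
  pose r := Ordinal ltn1.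
  have pr : p != r by rewrite -val_eqE /= neq_ltn ltnSn.
  have rq : r != q by rewrite -val_eqE /= neq_ltn qp2 ltnSn.
  have sa : simple_roots (eps R r - eps R p) by exists p, r.
  have sb : simple_roots (eps R q - eps R r) by exists r, q.
  have ab : eps R r - eps R p != eps R q - eps R r.
    apply/eqP => /(root_inj pr) [pr' _].
    by rewrite pr' eqxx in pr.
  case: (h2 _ _ sa sb ab) => [reg|/simple_root_tau_orbitF []//|/simple_root_tau_orbitF []//].
  have := reg (eps R q - eps R p); rewrite dot_root subr_eq0 eq_sym; apply.
  move=> A [hA2 hA1].
  (* The sum of two adjacent simple roots is the reflection of one in the other, so it lies in their
     subsystem. *)
  have -> : eps R q - eps R p = reflection (eps R r - eps R p) (eps R q - eps R r).
    rewrite reflection_root // act_root tpermR tpermD // -val_eqE /= qp2; lia.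
  by apply: hA2; apply: hA1; [left|right].
(* Conversely, it suffices to put the generating roots into classes of indices that are at most 2
   apart. *)
have reg (K : set 'rV[R]_n) (c : 'I_n -> nat) :
    (forall b, K b -> exists i j, [/\ i != j, c i = c j & b = eps R j - eps R i]) ->
    (forall i j, (i < j)%N -> c i = c j -> (j <= i + 2)%N) ->
    regular_on K gamma.
  move=> hK hc a /(root_subsystem_class hK) [i [j [ij cij ->]]].
  rewrite dot_root subr_eq0; case: (ltngtP i j) => lt_ij.
  - by rewrite eq_sym; apply: h; rewrite lt_ij hc.
  - by apply: h; rewrite lt_ij hc.
  - by rewrite (val_inj lt_ij) eqxx in ij.
have adj_neq (k l : 'I_n) : l = k.+1 :> nat -> k != l.
  by move=> lk; rewrite -val_eqE /= lk neq_ltn ltnSn.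
split=> [a [i [j [ij ->]]]|a b [i [j [ij ->]]] [p [q [pq ->]]] ab].
  apply: (reg _ (fun k => if (k == i) || (k == j) then 0 else k.+1)%N).
    by move=> b ->; exists i, j; rewrite !eqxx orbT adj_neq.
  move=> k l kl; case: ifP => [/orP[]/eqP->|_]; case: ifP => [/orP[]/eqP->|_]; lia.
apply: Or31.
(* Roots sharing an index merge [i], [j], [p], [q] into one class of three consecutive indices;
   otherwise there are two classes of two. The value [k.+2] keeps every other index alone. *)
pose c k := (if (k == i) || (k == j) then 0 else
             if (k == p) || (k == q) then (if (j == p) || (q == i) then 0 else 1)
             else k.+2)%N.
have cE k : c k = (if (k == i :> nat) || (k == j :> nat) then 0 else
             if (k == p :> nat) || (k == q :> nat) then
               (if (j == p :> nat) || (q == i :> nat) then 0 else 1)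
             else k.+2)%N by [].
have ip : (i <> p :> nat).
  by move=> /val_inj ip; move: ab; rewrite ip (@val_inj _ _ _ j q) ?eqxx //= ij pq ip.
apply: (reg _ c) => [x [->|->]|k l kl].
- by exists i, j; rewrite !cE !eqxx orbT adj_neq.
- by exists p, q; rewrite adj_neq //; split=> //; rewrite !cE; do !case: eqP => //=; lia.
- rewrite !cE; do !case: eqP => //=; lia.
Qed.

End Roots.

(** * Linear extensions of local orders *)

Definition linear_extension n (e : rel 'I_n) (w : 'S_n) : Prop :=
  forall x y, e x y -> (w x < w y)%N.

Section KeyOrder.
Local Open Scope set_scope.
Variables (n : nat) (key : 'I_n -> nat).
Hypothesis key_inj : injective key.

Definition key_pos x := #|[set z | (key z < key x)%N]|.

Lemma key_pos_lt x y : (key x < key y)%N -> (key_pos x < key_pos y)%N.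
Proof.
move=> lt_xy; apply: proper_card; apply/properP; split.
  by apply/fintype.subsetP => z; rewrite !inE => /ltn_trans; apply.
by exists x; rewrite !inE // ltnn.
Qed.

Lemma key_pos_ltn x : (key_pos x < n)%N.
Proof.
rewrite -[X in (_ < X)%N]card_ord -cardsT; apply: proper_card.
by apply/properP; split; [exact/fintype.subsetP | exists x; rewrite !inE ?ltnn].
Qed.

Lemma key_pos_ord_inj : injective (fun x => Ordinal (key_pos_ltn x)).
Proof.
move=> x y [E]; apply: key_inj.
by case: (ltngtP (key x) (key y)) => // /key_pos_lt; rewrite E ltnn.
Qed.

Definition key_perm : 'S_n := perm key_pos_ord_inj.

Lemma key_perm_lt x y : (key x < key y)%N -> (key_perm x < key_perm y)%N.
Proof. by rewrite !permE; apply: key_pos_lt. Qed.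

(** Whatever precedes [y] either precedes [x] or has its key in the range from [x] to [y]. *)
Lemma key_perm_gap x y :
  (key_perm y <= key_perm x + #|[set z | (key x <= key z < key y)%N]|)%N.
Proof.
rewrite !permE /= /key_pos; apply: leq_trans (leq_card_setU _ _).
apply: subset_leq_card; apply/fintype.subsetP => z; rewrite !inE => ->.
by rewrite andbT ltnNge orNb.
Qed.

End KeyOrder.

Section LocalOrder.
Local Open Scope set_scope.
Variables (n : nat) (d : 'I_n -> int) (e : rel 'I_n).
Implicit Types x y z : 'I_n.

(* [e] restricts to a strict total order on any two adjacent diagonals, and
   only relates boxes on such diagonals. *)
Record local_order : Prop := LocalOrder {
  e_irr : forall x, ~~ e x x;
  e_loc : forall x y, e x y -> `|d x - d y| <= 1;
  e_total : forall x y, x != y -> `|d x - d y| <= 1 -> e x y || e y x;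
  e_trans : forall x y z, e x y -> e y z -> `|d x - d z| <= 1 -> e x z
}.
Hypothesis he : local_order.

Inductive monotone_chain (s : int) : 'I_n -> 'I_n -> Prop :=
| chain1 x y : e x y -> d y = d x + s -> monotone_chain s x y
| chainS x y z : e x y -> d y = d x + s -> monotone_chain s y z ->
    monotone_chain s x z.

(** Normal forms of nonempty [e]-paths: one edge inside a diagonal, or a path crossing the diagonals
    in a single direction. *)
Definition reach x y : Prop :=
  [\/ e x y /\ d x = d y, monotone_chain 1 x y | monotone_chain (-1) x y].

Lemma monotone_chain_up x y : monotone_chain 1 x y -> d x < d y.
Proof. by elim=> [{}x {}y _ -> | {}x {}y z _ dy _]; lia. Qed.

Lemma monotone_chain_down x y : monotone_chain (-1) x y -> d y < d x.
Proof. by elim=> [{}x {}y _ -> | {}x {}y z _ dy _]; lia. Qed.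

Lemma monotone_chain_first s x y : monotone_chain s x y ->
  exists2 c, e x c /\ d c = d x + s & c = y \/ monotone_chain s c y.
Proof.
case=> [{}x {}y exy dy|{}x c {}y exc dc cy]; first by exists y; [|left].
by exists c; [|right].
Qed.

Lemma monotone_chain_last s x y : monotone_chain s x y ->
  exists2 c, e c y /\ d y = d c + s & c = x \/ monotone_chain s x c.
Proof.
elim=> [{}x {}y exy dy|{}x {}y z exy dy _ [c hc [cy|yc]]].
- by exists x; [|left].
- by exists c => //; right; rewrite cy; apply: chain1.
- by exists c => //; right; apply: chainS yc.
Qed.

(* Local extrema of the diagonal along a path can be short-cut. *)
Lemma edge_reach x y z : e x y -> reach y z -> reach x z.
Proof.
move=> exy; have lxy := e_loc he exy.
have key s : (s = 1 \/ s = -1) -> monotone_chain s y z ->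
    (e x z /\ d x = d z) \/ monotone_chain s x z.
  move=> hs yz.
  have [t dy] : exists t, d y = d x + t by exists (d y - d x); lia.
  have [ts|ts|ts] : [\/ t = s, t = 0 | t = - s].
    have [t1|[t1|t1]] : t = 1 \/ t = 0 \/ t = - 1 by lia.
    - by case: hs => ->; [constructor 1|constructor 3].
    - by constructor 2.
    - by case: hs => ->; [constructor 3|constructor 1].
  - by right; apply: chainS yz; rewrite // dy ts.
  - case: yz exy lxy dy => [{}y {}z eyz dz|{}y b {}z eyb db bz] exy lxy dy.
      by right; apply: chain1; [apply: (e_trans he exy eyz); lia | lia].
    by right; apply: chainS bz; [apply: (e_trans he exy eyb); lia | lia].
  (* Turning back: the edge and the first step of the chain compose to an edge from [x] to [b]
     inside one diagonal, which the next step of the chain absorbs. *)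
  - case: yz exy lxy dy => [{}y {}z eyz dz|{}y b {}z eyb db bz] exy lxy dy.
      by left; split; [apply: (e_trans he exy eyz); lia | lia].
    have exb : e x b by apply: (e_trans he exy eyb); lia.
    right; clear eyb; case: bz exb db => [{}b {}z ebz dz|{}b c {}z ebc dc cz] exb db.
      by apply: chain1; [apply: (e_trans he exb ebz); lia | lia].
    by apply: chainS cz; [apply: (e_trans he exb ebc); lia | lia].
case=> [[eyz dyz]|up|dn].
- have exz : e x z by apply: (e_trans he exy eyz); lia.
  have [E|E|E] : [\/ d x = d z, d z = d x + 1 | d z = d x - 1].
    have [E|[E|E]] : d x = d z \/ d z = d x + 1 \/ d z = d x - 1 by lia.
    by constructor 1. by constructor 2. by constructor 3.
  + by constructor 1.
  + by constructor 2; apply: chain1.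
  + by constructor 3; apply: chain1.
- by case: (key 1 (or_introl erefl) up); [constructor 1|constructor 2].
- by case: (key (-1) (or_intror erefl) dn); [constructor 1|constructor 3].
Qed.

Lemma reach1 x y : e x y -> reach x y.
Proof.
move=> exy; have := e_loc he exy => lxy.
have [E|[E|E]] : d x = d y \/ d y = d x + 1 \/ d y = d x - 1 by lia.
- by constructor 1.
- by constructor 2; apply: chain1.
- by constructor 3; apply: chain1.
Qed.

Lemma connect_reach x y : connect e x y -> x = y \/ reach x y.
Proof.
case/connectP => p; elim: p x => [|z p IHp] x /= => [_ ->|]; first by left.
case/andP=> exz /IHp{}IHp /IHp [<-|zy]; right; first exact: reach1.
exact: edge_reach zy.
Qed.

Lemma chain_connect s x y : monotone_chain s x y -> connect e x y.
Proof.
elim=> [{}x {}y exy _|{}x {}y z exy _ _]; first exact: connect1.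
exact/connect_trans/connect1.
Qed.

Lemma reachxx x : ~ reach x x.
Proof.
case=> [[exx _]|/monotone_chain_up|/monotone_chain_down]; rewrite ?ltxx //.
by have := e_irr he x; rewrite exx.
Qed.

(** A cycle would reduce to a normal form from a box to itself, but [e] is irreflexive and monotone
    chains change the diagonal. Hence the local orders generate a partial order. *)
Lemma connect_asym x y : e x y -> ~~ connect e y x.
Proof.
move=> exy; apply/negP => /connect_reach [yx|/(edge_reach exy)/reachxx //].
by have := e_irr he x; rewrite {2}yx exy || rewrite -{2}yx exy.
Qed.

Lemma connect_edge x y : x != y -> `|d x - d y| <= 1 -> connect e x y -> e x y.
Proof.
move=> xy dxy cxy; case/orP: (e_total he xy dxy) => // /connect_asym.
by rewrite cxy.
Qed.

(** A numerical rank that grows along [e], used to sort boxes within a block of an enumeration. *)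
Definition height x := #|[set z | connect e z x]|.

Lemma height_lt x y : e x y -> (height x < height y)%N.
Proof.
move=> exy; apply: proper_card; apply/properP; split.
  apply/fintype.subsetP => z; rewrite !inE => zx.
  exact: connect_trans zx (connect1 exy).
exists y; rewrite !inE ?connect0 //; exact: connect_asym.
Qed.

Lemma height_leq x : (height x <= n)%N.
Proof. by rewrite -[X in (_ <= X)%N]card_ord max_card. Qed.

Definition interval x y := [set z | connect e x z && connect e z y].

(* Enumerate what is not above [x], then the interval, then the rest. *)
Lemma linear_extension_interval x y : e x y ->
  exists2 w : 'S_n, linear_extension e w &
    (w x < w y)%N /\ (w y < w x + #|interval x y|)%N.
Proof.
move=> exy.
(* The key is lexicographic in block [L], height and index: heights are at most [n], whence the
   factor [n.+1], and the index modulo [n] makes the key injective. *)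
pose L z : nat := if connect e x z then (if connect e z y then 1 else 2) else 0.
pose key z : nat := ((L z * n.+1 + height z) * n + z)%N.
have L_mono z t : e z t -> (L z <= L t)%N.
  move=> ezt; rewrite /L; case xz: (connect e x z) => //.
  rewrite (connect_trans xz (connect1 ezt)).
  case zy: (connect e z y); first by case: ifP.
  case ty: (connect e t y) => //.
  by rewrite (connect_trans (connect1 ezt) ty) in zy.
have key_lt z t : (L z * n.+1 + height z < L t * n.+1 + height t)%N ->
    (key z < key t)%N.
  rewrite /key; have := ltn_ord z; nia.
have key_inj : injective key.
  move=> z t /(congr1 (modn^~ n)); rewrite /= /key !modnMDl !modn_small //.
  exact: val_inj.
have key_e z t : e z t -> (key z < key t)%N.
  move=> ezt; apply: key_lt; have := height_lt ezt; have := L_mono _ _ ezt.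
  nia.
have key_L z t : (L z < L t)%N -> (key z < key t)%N.
  move=> lzt; apply: key_lt; have := height_leq z; nia.
exists (key_perm key_inj) => [z t ezt|]; first exact/key_perm_lt/key_e.
split; first exact/key_perm_lt/key_e.
apply: leq_ltn_trans (key_perm_gap key_inj x y) _; rewrite ltn_add2l.
(* The bound is strict because [y] belongs to the interval but its key is not below itself. *)
apply: proper_card; apply/properP; split.
  apply/fintype.subsetP => z; rewrite !inE => /andP[xz zy].
  have Lx : L x = 1%N by rewrite /L connect0 (connect1 exy).
  have Ly : L y = 1%N by rewrite /L connect0 (connect1 exy).
  have : L z = 1%N.
    case: (ltngtP (L z) 1%N) => // [lz|lz].
      by move: xz; rewrite leqNgt key_L // Lx.
    by move: zy; rewrite ltnNge ltnW // key_L // Ly.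
  by rewrite /L; case: (connect e x z); case: (connect e z y).
by exists y; rewrite !inE ?connect0 ?ltnn ?andbF // andbT connect1.
Qed.

(** By antisymmetry of reachability, an endpoint that has been moved drops out of the interval; this
    lets minimal counterexamples be used. *)
Lemma interval_proper x y u v : connect e x u -> connect e v y ->
  (u != x \/ v != y) -> e u v ->
  (#|interval u v| < #|interval x y|)%N.
Proof.
move=> xu vy hne euv; apply: proper_card; apply/properP; split.
  apply/fintype.subsetP => z; rewrite !inE => /andP[uz zv].
  by rewrite (connect_trans xu uz) (connect_trans zv vy).
have xy : connect e x y := connect_trans xu (connect_trans (connect1 euv) vy).
have asym a b : a != b -> connect e a b -> ~~ connect e b a.
  move=> ab /connect_reach [E|ab']; first by rewrite E eqxx in ab.
  apply/negP => /connect_reach [E|ba]; first by rewrite E eqxx in ab.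
  have rtrans : connect e a b by case: ab' => [[/connect1]|/chain_connect|/chain_connect].
  case/connectP: rtrans ab => [[|c p] /= ]; first by move=> _ -> ; rewrite eqxx.
  case/andP=> eac pth lst _; have := connect_asym eac; apply/negP/negPn.
  have cb : connect e c b by apply/connectP; exists p.
  apply: (connect_trans cb).
  by case: ba => [[/connect1]|/chain_connect|/chain_connect].
case: hne => [ux|vy'].
  exists x; rewrite !inE ?connect0 ?xy //.
  by rewrite negb_and asym // eq_sym.
exists y; rewrite !inE ?connect0 ?xy ?andbT //.
by rewrite negb_and (asym v y) ?orbT.
Qed.

(* Minimal counterexample: if no box of diagonal [d x + 1] lies between [x] and
   [y], and the interval is minimal for that, then it contains besides [x] and
   [y] at most one box, on diagonal [d x - 1]. *)
Lemma between_right :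
  (forall w, linear_extension e w -> forall x y, x != y -> d x = d y ->
     (w x < w y)%N -> (w x + 2 < w y)%N) ->
  forall x y, e x y -> d x = d y -> exists z, [/\ d z = d x + 1, e x z & e z y].
Proof.
move=> hw x y; have [m] := ubnP #|interval x y|.
elim: m x y => // m IH x y lt_m exy dxy.
have neq u v : e u v -> u != v.
  by move=> euv; apply/eqP => E; have := e_irr he u; rewrite {2}E euv.
have [/existsP[z /and3P[/eqP dz xz zy]]|no_right] :=
  boolP [exists z, [&& d z == d x + 1, e x z & e z y]]; first by exists z.
exfalso; have {}no_right z : d z = d x + 1 -> e x z -> ~ e z y.
  move=> dz xz zy; case/negP: no_right; apply/existsP; exists z.
  by rewrite dz eqxx xz zy.
(* The smaller pair [x], [z] has a box of the right diagonal in between, which would also lie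
   between [x] and [y]. *)
have no_same z : d z = d x -> e x z -> ~ e z y.
  move=> dz xz zy.
  have lt_xz : (#|interval x z| < m)%N.
    rewrite -ltnS; apply: leq_trans lt_m; rewrite ltnS.
    by apply: (interval_proper (connect0 e x) (connect1 zy) _ xz); right; apply: neq.
  have [//|t [dt xt tz]] := IH x z lt_xz xz.
  by apply: (no_right t) => //; apply: (e_trans he tz zy); lia.
(* Two boxes on the left diagonal form a smaller pair, and the box between them would contradict
   [no_same]. *)
have no_two k l : d k = d x - 1 -> e x k -> e l y -> d l = d k -> ~ e k l.
  move=> dk xk ly dl kl.
  have lt_kl : (#|interval k l| < m)%N.
    rewrite -ltnS; apply: leq_trans lt_m; rewrite ltnS.
    apply: (interval_proper (connect1 xk) (connect1 ly) _ kl).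
    by left; rewrite eq_sym; apply: neq.
  have [//|t [dt kt tl]] := IH k l lt_kl kl.
  apply: (no_same t); first lia.
    by apply: (e_trans he xk kt); lia.
  by apply: (e_trans he tl ly); lia.
pose K := [set k | [&& d k == d x - 1, e x k & e k y]].
have K1 : (#|K| <= 1)%N.
  rewrite leqNgt; apply/negP => /card_gt1P [k [l [kK lK kl]]].
  move: kK lK; rewrite !inE => /and3P[/eqP dk xk ky] /and3P[/eqP dl xl ly].
  have dkl : `|d k - d l| <= 1 by lia.
  case/orP: (e_total he kl dkl).
    by apply: no_two => //; rewrite dl.
  by apply: no_two => //; rewrite dk.
have edge_y c : d c = d x + 1 \/ d c = d x - 1 -> connect e c y -> e c y.
  move=> dc; apply: connect_edge; last lia.
  by apply/eqP => E; move: dc; rewrite E; lia.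
have sub : interval x y \subset [set x; y] :|: K.
  apply/fintype.subsetP => z; rewrite !inE => /andP[xz zy].
  have [//|zx] := eqVneq z x; have [//|zy'] := eqVneq z y; rewrite /=.
  case: (connect_reach xz) => [E|]; first by rewrite E eqxx in zx.
  have tail s c : c = z \/ monotone_chain s c z -> connect e c z.
    by case=> [->|/chain_connect].
  case=> [[exz dz]|/monotone_chain_first [c [xc dc] /tail cz]|].
  - by case: (no_same z) => //; apply: connect_edge => //; lia.
  - case: (no_right c dc xc); apply: edge_y; first by left.
    exact: connect_trans cz zy.
  - move=> /monotone_chain_first [c [xc dc] cz].
    have ecy : e c y.
      by apply: edge_y (connect_trans (tail _ _ cz) zy); right.
    case: cz => [<-|cz]; first by rewrite dc eqxx xc ecy.
    have dz := monotone_chain_down cz.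
    (* Here [z] lies left of the diagonal of [c], so the path must return to [y] through a second
       box [l] of that diagonal, which [no_two] excludes. *)
    case: (connect_reach zy) => [E|[[_ E]|zy2|/monotone_chain_down]]; [|lia| |lia].
      by rewrite E eqxx in zy'.
    case/monotone_chain_last: zy2 => l [ely dl] zl.
    have czl : connect e c l.
      apply: connect_trans (chain_connect cz) _.
      by case: zl => [->|/chain_connect].
    have cl : c != l.
      apply/eqP => E; have [b [cb _] /tail bz] := monotone_chain_first cz.
      apply/negP: (connect_asym cb); rewrite negbK; apply: connect_trans bz _.
      by rewrite E; case: zl => [->|/chain_connect].
    by case: (no_two c l) => //; [lia | apply: connect_edge => //; lia].
have card_xy : (#|interval x y| <= 3)%N.
  apply: leq_trans (subset_leq_card sub) _.
  by apply: leq_trans (leq_card_setU _ _) _; rewrite cards2; case: (x != y); lia.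
(* With at most three boxes in the interval, this extension gives [x] and [y] entries at most 2
   apart. *)
have [w w_ext [lt_w w_gap]] := linear_extension_interval exy.
by have := hw w w_ext x y (neq _ _ exy) dxy lt_w; lia.
Qed.

End LocalOrder.

(* Reversing the order of the diagonals exchanges the two sides. *)
Lemma between_left n (d : 'I_n -> int) (e : rel 'I_n) : local_order d e ->
  (forall w, linear_extension e w -> forall x y, x != y -> d x = d y ->
     (w x < w y)%N -> (w x + 2 < w y)%N) ->
  forall x y, e x y -> d x = d y -> exists z, [/\ d z = d x - 1, e x z & e z y].
Proof.
case=> irr loc tot trans hw x y exy dxy.
have he : local_order (fun x => - d x) e.
  split=> // [a b /loc|a b ab dab|a b c eab ebc dac]; first lia.
    by apply: tot ab _; lia.
  by apply: trans eab ebc _; lia.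
have [||z [dz xz zy]] := @between_right n _ e he _ x y exy.
- by move=> w wext a b ab dab; apply: hw wext _ _ ab _; lia.
- by rewrite dxy.
- by exists z; split=> //; lia.
Qed.

(** * The order of the boxes of a placed shape *)

Section BoxOrder.
Variables (R : realType) (n : nat) (gamma : 'rV[R]_n) (J : set 'rV[R]_n).
Variable d : 'I_n -> int.
Implicit Types x y z : 'I_n.

(** Box [x] is northwest of box [y]. A root of [Pset gamma] outside [J] puts the box on the higher
    diagonal southeast, one in [J] puts it northwest. *)
Definition box_order : rel 'I_n := fun x y =>
  [|| (d x == d y) && (x < y)%N,
      (d y == d x + 1) && ~~ `[< J (eps R y - eps R x) >] |
      (d x == d y + 1) && `[< J (eps R x - eps R y) >]].

Hypothesis dE : forall x, (d x)%:~R = gamma 0 x.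
Hypothesis gamma_shape : placed_shape gamma J.

Lemma diag_sorted x y : (x <= y)%N -> d x <= d y.
Proof. by move/gamma_shape.1; rewrite -!dE ler_int. Qed.

Lemma diag_lt x y : d x < d y -> (x < y)%N.
Proof. by move=> dxy; rewrite ltnNge; apply/negP => /diag_sorted; lia. Qed.

Lemma dot_diag x y (k : int) :
  dot gamma (eps R y - eps R x) = k%:~R <-> d y = d x + k.
Proof.
rewrite dot_root -!dE -rmorphB; split=> [/intr_inj|->]; first by lia.
by congr (_%:~R); lia.
Qed.

Lemma PsetP x y : Pset gamma (eps R y - eps R x) <-> d y = d x + 1.
Proof.
split=> [[_ h]|dyx]; first exact: (dot_diag x y 1).1.
split; last exact: (dot_diag x y 1).2.
by exists x, y; split=> //; apply/eqP => E; move: dyx; rewrite E; lia.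
Qed.

Lemma ZsetP x y : Zset gamma (eps R y - eps R x) <-> (x < y)%N /\ d x = d y.
Proof.
split=> [[hpos h]|[xy dxy]].
  have -> : d x = d y by have := (dot_diag x y 0).1 h; lia.
  have [E|xy] := eqVneq x y; last by move/(pos_rootP R xy): hpos.
  case: hpos => p [q [pq]]; rewrite E subrr => /esym/eqP.
  rewrite subr_eq0 => /eqP eqp; have qp : q != p by rewrite neq_ltn pq orbT.
  have [] := @root_inj R n p q q p; rewrite 1?eq_sym ?eqp ?subrr //.
  by move=> pq'; rewrite pq' ltnn in pq.
split; first by exists x, y.
by apply/(dot_diag x y 0); lia.
Qed.

Lemma J_diag x y : J (eps R y - eps R x) -> d y = d x + 1.
Proof. by move/gamma_shape.2/PsetP. Qed.

Lemma box_order_same x y : d x = d y -> box_order x y = (x < y)%N.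
Proof.
move=> E; rewrite /box_order E eqxx /=.
have -> : (d y == d y + 1) = false by lia.
by rewrite orbF.
Qed.

Lemma box_order_up x y : d y = d x + 1 ->
  box_order x y = ~~ `[< J (eps R y - eps R x) >].
Proof.
move=> E; rewrite /box_order E eqxx /=.
have -> : (d x == d x + 1) = false by lia.
have -> : (d x == d x + 1 + 1) = false by lia.
by rewrite orbF.
Qed.

Lemma box_order_down x y : d y = d x + 1 ->
  box_order y x = `[< J (eps R y - eps R x) >].
Proof.
move=> E; rewrite /box_order E eqxx /=.
have -> : (d x + 1 == d x) = false by lia.
have -> : (d x == d x + 1 + 1) = false by lia.
by [].
Qed.

(** Pairs on one diagonal give [Zset gamma] and must not be inverted; pairs on adjacent diagonals
    give [Pset gamma] and are inverted exactly when in [J]. *)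
Lemma tableauxP w : tableaux gamma J w <-> linear_extension box_order w.
Proof.
have wlt x y : x != y -> ~ (w y < w x)%N -> (w x < w y)%N.
  rewrite -(inj_eq (@perm_inj _ w)) -val_eqE /= => wxy /negP.
  by rewrite -leqNgt ltn_neqAle wxy.
split=> [[hZ hP] x y|hw].
- case/or3P => /andP[/eqP dxy].
  + move=> xy; apply: wlt => [|wyx]; first by rewrite -val_eqE /= neq_ltn xy.
    suff : (inversions w `&` Zset gamma) (eps R y - eps R x) by rewrite hZ.
    by split; [apply/inversionP | apply/ZsetP].
  + move=> /asboolP nJ; have xy : (x < y)%N by apply: diag_lt; lia.
    apply: wlt => [|wyx]; first by rewrite -val_eqE /= neq_ltn xy.
    by apply: nJ; rewrite -hP; split; [apply/inversionP | apply/PsetP].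
  + by move=> /asboolP; rewrite -hP => -[/inversionP[]].
- split.
    apply/seteqP; split=> // _ [[[x [y [xy ->]]] +] /ZsetP[_ dxy]].
    rewrite act_root opprB pos_rootP ?(inj_eq perm_inj); last first.
      by rewrite -val_eqE /= neq_ltn xy orbT.
    have := hw x y; rewrite box_order_same // => /(_ xy) /ltnW.
    by rewrite leqNgt => /negP.
  apply/seteqP; split=> [_ [[[x [y [xy ->]]] +] /PsetP dxy]|a Ja].
    rewrite act_root opprB pos_rootP ?(inj_eq perm_inj); last first.
      by rewrite -val_eqE /= neq_ltn xy orbT.
    move=> wyx; apply: contrapT => nJ; have := hw x y.
    rewrite box_order_up // => /(_ (introN (asboolP _) nJ)) /ltnW.
    by rewrite leqNgt wyx.
  split; last exact: gamma_shape.2.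
  have [[x [y [_ aE]]] _] := gamma_shape.2 _ Ja; rewrite aE in Ja *.
  have dxy := J_diag Ja; apply/inversionP; split; first by apply: diag_lt; lia.
  by apply: hw; rewrite box_order_down //; apply/asboolP.
Qed.

(** Coordinate [p] of [act w gamma] is the diagonal of the box with entry [p], so regularity
    compares the diagonals of boxes with nearby entries. *)
Lemma generalized_linear_extension :
  generalized_placed_skew_shape gamma J <->
  (forall w, linear_extension box_order w -> forall x y, x != y -> d x = d y ->
     (w x < w y)%N -> (w x + 2 < w y)%N).
Proof.
split=> h w.
- move=> /tableauxP /h /regular_simple_pairsP hw x y _ dxy lt_w.
  rewrite ltnNge; apply/negP => le_w.
  have := hw (w x) (w y); rewrite lt_w le_w !act_coord -!dE dxy eqxx.
  by move/(_ isT).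
- move=> /tableauxP /h hw; apply/regular_simple_pairsP => p q /andP[pq qp].
  apply/negP; rewrite !mxE -!dE eqr_int => /eqP dpq.
  have := hw _ _ _ dpq; rewrite !permKV (inj_eq perm_inj) pq -val_eqE /=.
  by rewrite neq_ltn pq => /(_ isT isT); lia.
Qed.

Hypothesis J_closed : forall alpha beta : 'rV[R]_n, J beta ->
  Zset gamma alpha -> pos_roots (beta - alpha) -> J (beta - alpha).

(** Subtracting a root of [Zset gamma] slides the northwest box of a pair further northwest; the
    companion lemma slides the other box further southeast. *)
Lemma J_closed_head x y y' : J (eps R y - eps R x) -> d y' = d y ->
  (y' <= y)%N -> J (eps R y' - eps R x).
Proof.
rewrite leq_eqVlt => Jxy dy /predU1P[/val_inj->//|yy'].
have dyx := J_diag Jxy.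
have E : eps R y' - eps R x = (eps R y - eps R x) - (eps R y - eps R y').
  by rewrite opprB [RHS]addrC addrA addrNK.
rewrite E; apply: J_closed => //; first exact/ZsetP.
by rewrite -E; exists x, y'; split=> //; apply: diag_lt; lia.
Qed.

Lemma J_closed_tail x x' y : J (eps R y - eps R x) -> d x' = d x ->
  (x <= x')%N -> J (eps R y - eps R x').
Proof.
rewrite leq_eqVlt => Jxy dx /predU1P[/val_inj<-//|xx'].
have dyx := J_diag Jxy.
have E : eps R y - eps R x' = (eps R y - eps R x) - (eps R x' - eps R x).
  by rewrite opprB [RHS]addrA addrNK.
rewrite E; apply: J_closed => //; first by apply/ZsetP; split.
by rewrite -E; exists x', y; split=> //; apply: diag_lt; lia.
Qed.

(** Irreflexivity, locality and totality are built into the order; transitivity is the closure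
    property of [J]. *)
Lemma box_order_local : local_order d box_order.
Proof.
have Jhead x y y' : `[< J (eps R y - eps R x) >] -> d y' = d y ->
    (y' <= y)%N -> `[< J (eps R y' - eps R x) >].
  by move=> /asboolP Jxy dy yy'; apply/asboolP; apply: J_closed_head Jxy _ _.
have Jtail x x' y : `[< J (eps R y - eps R x) >] -> d x' = d x ->
    (x <= x')%N -> `[< J (eps R y - eps R x') >].
  by move=> /asboolP Jxy dx xx'; apply/asboolP; apply: J_closed_tail Jxy _ _.
split=> [x|x y|x y xy|x y z].
- by rewrite box_order_same ?ltnn.
- by case/or3P => /andP[/eqP]; lia.
- move=> dxy; have [E|[E|E]] : d x = d y \/ d y = d x + 1 \/ d x = d y + 1 by lia.
  + by rewrite !box_order_same // -neq_ltn.
  + by rewrite box_order_up // box_order_down // orNb.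
  + by rewrite box_order_down // box_order_up // orbN.
- move=> exy eyz dxz.
  have [E|[E|E]] : d x = d z \/ d z = d x + 1 \/ d x = d z + 1 by lia.
  + rewrite box_order_same // ltnNge; apply/negP => zx.
    case/or3P: exy => /andP[/eqP Exy].
    * move: eyz; rewrite box_order_same; lia.
    * move=> /negP; apply; move: eyz; rewrite box_order_down; last lia.
      by move=> /Jtail; apply; lia.
    * move=> Jxy; move: eyz; rewrite box_order_up; last lia.
      by move/negP; apply; apply: Jhead Jxy _ _; lia.
  + rewrite box_order_up //; apply/negP => Jxz.
    case/or3P: exy => /andP[/eqP Exy].
    * move=> xy; move: eyz; rewrite box_order_up; last lia.
      by move/negP; apply; apply: Jtail Jxz _ _; lia.
    * move/negP; apply; move: eyz; rewrite box_order_same; last lia.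
      by move=> yz; apply: Jhead Jxz _ _; lia.
    * by case/or3P: eyz => /andP[/eqP]; lia.
  + rewrite box_order_down //.
    case/or3P: exy => /andP[/eqP Exy].
    * move=> xy; move: eyz; rewrite box_order_down; last lia.
      by move/Jhead; apply; lia.
    * by case/or3P: eyz => /andP[/eqP]; lia.
    * move=> Jxy; move: eyz; rewrite box_order_same; last lia.
      by move=> yz; apply: Jtail Jxy _ _; lia.
Qed.

End BoxOrder.

(** * Skew diagrams and convex sets of boxes *)

Definition convex_boxes (S : set (int * int)) : Prop :=
  forall b c b', S b -> S b' ->
    row_of b <= row_of c <= row_of b' -> col_of b <= col_of c <= col_of b' -> S c.

Lemma partition_nth_le la r s : is_partition la -> (r <= s)%N ->
  (nth 0 la s <= nth 0 la r)%N.
Proof.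
case/andP=> la_sorted _ rs.
have [la_s|s_la] := leqP (size la) s; first by rewrite nth_default.
have geq_trans : transitive geq by move=> a b c ba ac; apply: leq_trans ac ba.
apply: (sorted_leq_nth geq_trans leqnn 0%N la_sorted) => //.
by rewrite inE; apply: leq_ltn_trans s_la.
Qed.

Lemma partition_of_antitone (f : nat -> nat) N :
  (forall r s, (r <= s)%N -> (f s <= f r)%N) -> f N = 0%N ->
  exists2 la, is_partition la & forall r, nth 0%N la r = f r.
Proof.
move=> f_anti fN.
have exN : exists r, f r == 0%N by exists N; rewrite fN.
(* Cutting at the first zero of [f] leaves only positive parts. *)
case: (ex_minnP exN) => m /eqP fm min_m.
have f_gt0 r : (r < m)%N -> (0 < f r)%N.
  by move=> rm; rewrite lt0n; apply/negP => /min_m; rewrite leqNgt rm.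
exists (mkseq f m) => [|r].
  apply/andP; split.
    have geq_trans : transitive geq by move=> a b c ba ac; apply: leq_trans ac ba.
    rewrite sorted_map sorted_pairwise.
      apply/(pairwiseP 0%N) => i j; rewrite !inE size_iota => im jm ij.
      by rewrite /= !nth_iota // f_anti // ltnW.
    by move=> a b c /= ba ac; apply: leq_trans ac ba.
  by apply/mapP => -[r]; rewrite mem_iota add0n => /f_gt0 + E; rewrite -E.
have [rm|mr] := ltnP r m; first by rewrite nth_mkseq.
by rewrite nth_default ?size_mkseq //; have := f_anti _ _ mr; lia.
Qed.

(** The bound from [mu] is inherited from the upper corner, the bound from [la] from the lower
    one. *)
Lemma placed_skew_diagram_convex la mu o :
  is_partition la -> is_partition mu -> convex_boxes (placed_skew_diagram la mu o).
Proof.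
move=> hla hmu b c b' [r [k [hrk ->]]] [r' [k' [hrk' ->]]].
rewrite /row_of /col_of /= => hr hc.
exists `|c.1 - o.1|%N, `|c.2 - o.2|%N; split; last first.
  by rewrite [LHS]surjective_pairing; congr pair; lia.
have := @partition_nth_le la `|c.1 - o.1|%N r' hla.
have := @partition_nth_le mu r `|c.1 - o.1|%N hmu.
lia.
Qed.

(* Row [r] of the diagram ends at the rightmost column reached weakly below it
   and starts at the leftmost column reached weakly above it (capped by the
   end, so that empty rows cause no harm). *)
Lemma convex_placed_skew_diagram n (box : 'I_n -> int * int) :
  convex_boxes (range box) ->
  exists la mu o, [/\ is_partition la, is_partition mu, partition_le mu la &
    placed_skew_diagram la mu o = range box].
Proof.
move=> cvx.
(* [B] bounds all coordinates in absolute value, so relative to the origin [(-B, -B)] they are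
   natural numbers and rows are at most [2B]. *)
pose B : nat := (\sum_(i < n) (`|(box i).1|%N + `|(box i).2|%N))%N.
have boxB i : (`|(box i).1|%N + `|(box i).2|%N <= B)%N.
  by rewrite /B (bigD1 i) //= leq_addr.
pose o : int * int := (- B%:Z, - B%:Z).
pose row i := absz ((box i).1 + B%:Z).
pose col i := absz ((box i).2 + B%:Z).
have boxE i : box i = (o.1 + (row i)%:Z, o.2 + (col i)%:Z).
  have := boxB i; rewrite [LHS]surjective_pairing /o /row /col /= => Bi.
  by congr pair; lia.
have row_le i : (row i < B.*2.+1)%N by have := boxB i; rewrite /row; lia.
pose f r := (\max_(i < n | r <= row i) (col i).+1)%N.
(* This is the minimum of the columns capped by [f r], written as a maximum of truncated
   differences; with no box weakly above it equals [f r]. *)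
pose g r := (f r - \max_(i < n | (row i <= r)%N) (f r - col i))%N.
have f_anti r s : (r <= s)%N -> (f s <= f r)%N.
  move=> rs; apply/bigmax_leqP => i si.
  by apply: leq_bigmax_cond; apply: leq_trans si.
have colf i : (col i < f (row i))%N.
  by apply: (@leq_bigmax_cond _ _ (fun i => (col i).+1)).
have gcol i r : (row i <= r)%N -> (g r <= col i)%N.
  move=> ri; have := @leq_bigmax_cond _ (fun i => (row i <= r)%N) (fun i => (f r - col i)%N) i ri.
  by rewrite /g !leq_subLR addnC.
have g_witness r : (g r < f r)%N -> exists2 i, (row i <= r)%N & (col i <= g r)%N.
  rewrite /g => g_lt_f.
  have [|i ri E] := @eq_bigmax_cond _ [pred i | (row i <= r)%N] (fun i => (f r - col i)%N).
    rewrite lt0n; apply/negP => /eqP /card0_eq none.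
    move: g_lt_f; rewrite big1 => [|i ri]; first lia.
    by have := none i; rewrite inE /= ri.
  by exists i => //; move: g_lt_f; rewrite E; lia.
have f_witness r k : (k < f r)%N -> exists2 i, (r <= row i)%N & (k <= col i)%N.
  move=> kf.
  have [|i ri E] := @eq_bigmax_cond _ [pred i | (r <= row i)%N] (fun i => (col i).+1).
    rewrite lt0n; apply/negP => /eqP /card0_eq none.
    move: kf; rewrite /f big1 // => i ri.
    by have := none i; rewrite inE /= ri.
  by exists i => //; move: kf; rewrite /f E ltnS.
have g_anti r s : (r <= s)%N -> (g s <= g r)%N.
  move=> rs; have [fg|/g_witness[i ri ci]] := leqP (f r) (g r).
    by apply: leq_trans fg; apply: leq_trans (leq_subr _ _) (f_anti _ _ rs).
  exact: leq_trans (gcol i s (leq_trans ri rs)) ci.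
have fN : f B.*2.+1 = 0%N.
  by rewrite /f big1 // => i; rewrite leqNgt row_le.
have [la la_part laE] := partition_of_antitone f_anti fN.
have gN : g B.*2.+1 = 0%N by rewrite /g fN.
have [mu mu_part muE] := partition_of_antitone g_anti gN.
exists la, mu, o; split=> // [r|]; first by rewrite laE muE leq_subr.
apply/seteqP; split=> [_ [r [k [gkf ->]]]|_ [i _ <-]].
  move: gkf; rewrite laE muE => /andP[gk kf].
  have [i ri ci] := g_witness r (leq_ltn_trans gk kf).
  have [j rj cj] := f_witness r k kf.
  apply: (cvx (box i) _ (box j)); [by exists i|by exists j| |];
    by rewrite (boxE i) (boxE j) /row_of /col_of /=; lia.
exists (row i), (col i); split; last exact: boxE.
by rewrite laE muE colf gcol.
Qed.

(** * Interlacing of adjacent diagonals and their packing *)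

(* [Q x y]: the [y]-th of the [m'] boxes of a diagonal is northwest of the
   [x]-th of the [m] boxes of the preceding one. *)
Lemma interlace (Q : nat -> nat -> bool) (m m' : nat) :
  (forall x y y', (x < m)%N -> (y < m')%N -> (y' <= y)%N -> Q x y -> Q x y') ->
  (forall x x' y, (x' < m)%N -> (y < m')%N -> (x <= x')%N -> Q x y -> Q x' y) ->
  (forall x, (x.+1 < m)%N -> exists y, [/\ (y < m')%N, ~~ Q x y & Q x.+1 y]) ->
  (forall y, (y.+1 < m')%N -> exists x, [/\ (x < m)%N, Q x y & ~~ Q x y.+1]) ->
  let s := (m == 0%N) || (0 < m')%N && Q 0%N 0%N in
  (forall x y, (x < m)%N -> (y < m')%N -> Q x y = (y < x + s)%N) /\
  (m' <= m + s <= m'.+1)%N.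
Proof.
move=> Qy Qx right left s.
have QE x y : (x < m)%N -> (y < m')%N -> Q x y = (y < x + s)%N.
  move=> xm ym.
  have sE : s = Q 0%N 0%N.
    by rewrite /s (gtn_eqF (leq_ltn_trans _ xm)) // (leq_ltn_trans _ ym).
  elim: x xm y ym => [|x IH] xm y ym.
    rewrite sE add0n; case: y ym => [|y] ym; first by case: (Q 0%N 0%N).
    have -> : (y.+1 < Q 0%N 0%N)%N = false by case: (Q 0%N 0%N).
    (* Otherwise every row of [Q] would contain 1, and nothing could separate 0 from 1. *)
    apply/negP => Q0y; have m'1 : (1 < m')%N by apply: leq_ltn_trans ym.
    have Q01 : Q 0%N 1%N by apply: Qy Q0y.
    have [x [xm' _]] := left 0%N m'1.
    by rewrite (Qx 0%N x 1%N).
  (* By induction the separating [t] is at least [x + s], so row [x.+1] contains everything below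
     [x.+1 + s]. *)
  have [t [tm' nQt Qt]] := right x xm.
  have xt : (x + s <= t)%N by rewrite leqNgt -IH // ltnW.
  have [ys|ys] := ltnP y (x.+1 + s); first by apply: Qy Qt; lia.
  (* Were row [x.+1] longer, no [z] could separate [x + s] from its successor: rows up to [x] miss
     both, later rows contain both. *)
  apply/negP => Qxy; have ym1 : ((x + s).+1 < m')%N by lia.
  have Qx1 : Q x.+1 (x + s).+1 by apply: Qy Qxy; lia.
  have [z [zm Qz nQz]] := left _ ym1.
  have [zx|xz] := leqP z x.
    have := Qx z x (x + s)%N (ltnW xm) (ltnW ym1) zx Qz.
    by rewrite IH ?ltnn //; lia.
  by rewrite (Qx x.+1 z) in nQz.
split=> //.
(* Next to an empty diagonal there is at most one box, since nothing separates two; the default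
   values of [s] then satisfy the bounds. *)
have [m0|m_gt0] := posnP m.
  have s1 : s = true by rewrite /s m0 eqxx.
  have m'1 : (m' <= 1)%N.
    by rewrite leqNgt; apply/negP => /left [x []]; rewrite m0.
  by rewrite s1 m0; lia.
have [m'0|m'_gt0] := posnP m'.
  have s0 : s = false by rewrite /s m'0 gtn_eqF.
  have m1 : (m <= 1)%N.
    by rewrite leqNgt; apply/negP => /right [x []]; rewrite m'0.
  by rewrite s0 m'0; lia.
(* If either bound failed, two consecutive boxes at the far end of the longer diagonal would remain
   unseparated. *)
apply/andP; split; rewrite leqNgt; apply/negP => lt_m.
  have /left [x [xm]] : ((m + s).-1.+1 < m')%N by lia.
  by rewrite QE //; lia.
have /right [y [ym]] : ((m - 2).+1 < m)%N by lia.
by rewrite QE //; lia.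
Qed.

(** Compare sizes: if [i] is in [A], so is all that precedes it; if not, [A] lies strictly below
    [i]. *)
Lemma initial_segment n (A : {set 'I_n}) :
  (forall i j : 'I_n, (i <= j)%N -> j \in A -> i \in A) ->
  forall i : 'I_n, (i \in A) = (i < #|A|)%N.
Proof.
move=> A_down i.
have card_lt k : (k <= n)%N -> #|[set j : 'I_n | (j < k)%N]%SET| = k.
  move=> kn.
  by rewrite -sum1dep_card -(big_ord_widen n (fun=> 1%N) kn) sum1_card card_ord.
have [iA|niA] := boolP (i \in A).
  apply/esym; rewrite -[X in (X <= _)%N](card_lt i.+1) //.
  apply/subset_leq_card/fintype.subsetP => j; rewrite inE ltnS => ji.
  exact: A_down ji iA.
apply/esym/negbTE; rewrite -leqNgt -[X in (_ <= X)%N](card_lt i (ltnW (ltn_ord i))).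
apply/subset_leq_card/fintype.subsetP => j jA; rewrite inE ltnNge.
by apply: contra niA => ij; apply: A_down ij jA.
Qed.

Lemma unit_step_bounds (a : nat -> int) k l :
  (forall i, a i - 1 <= a i.+1 <= a i) -> (k <= l)%N ->
  a k + k%:Z - l%:Z <= a l <= a k.
Proof.
move=> step; elim: l => [|l IH]; first by rewrite leqn0 => /eqP->; lia.
rewrite leq_eqVlt => /predU1P[->|kl]; first lia.
by have := IH kl; have := step l; lia.
Qed.

(* Each diagonal is filled with consecutive rows; [a k] is the top row of the
   [k]-th diagonal, and both boundaries rise by at most one row from a diagonal
   to the next, also across empty diagonals. *)
Lemma convex_placement n (d : 'I_n -> int) (e : rel 'I_n) :
  local_order d e ->
  (forall x y : 'I_n, (x <= y)%N -> d x <= d y) ->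
  (forall x y, d x = d y -> e x y = (x < y)%N) ->
  (forall x y, e x y -> d x = d y ->
     exists z, [/\ d z = d x + 1, e x z & e z y]) ->
  (forall x y, e x y -> d x = d y ->
     exists z, [/\ d z = d x - 1, e x z & e z y]) ->
  exists row : 'I_n -> int,
    [/\ forall x y : 'I_n, d x = d y -> (x < y)%N -> row x < row y,
        forall x y, d y = d x + 1 -> e y x = (row y < row x) &
        convex_boxes (range (fun x => (row x, row x + d x)))].
Proof.
move=> he d_sorted e_same right left.
have e_asym x y : e x y -> ~~ e y x.
  move=> exy; apply/negP => eyx; apply/negP: (e_irr he x); rewrite negbK.
  by apply: (e_trans he exy eyx); rewrite subrr normr0.
(* [M] is strictly below every diagonal, so the shifted diagonal 0 is empty and both boundaries
   start at row 0. *)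
have [M M_lt] : exists M, forall x, M < d x.
  exists (- (\sum_(x < n) absz (d x))%N%:Z - 1) => x.
  by rewrite (bigD1 x) //=; lia.
pose D x := absz (d x - M).
have DE x : d x = M + (D x)%:Z by have := M_lt x; rewrite /D; lia.
have D_gt0 x : (0 < D x)%N by have := M_lt x; rewrite /D; lia.
(* Since [d] is sorted, shifted diagonal [k] consists of the indices from [f k] up to but excluding
   [f k.+1]. *)
pose f k := #|[set x | (D x < k)%N]%SET|.
have fE k x : (D x < k)%N = (x < f k)%N.
  rewrite -initial_segment ?inE // => i j ij; rewrite !inE.
  by have := d_sorted _ _ ij; have := DE i; have := DE j; lia.
have f_mono k : (f k <= f k.+1)%N.
  by apply/subset_leq_card/fintype.subsetP => x; rewrite !inE; lia.
have f_le k : (f k <= n)%N by rewrite -[X in (_ <= X)%N]card_ord max_card.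
pose m k := (f k.+1 - f k)%N.
have diagP k x : D x = k <-> (f k <= x < f k.+1)%N.
  by have := fE k x; have := fE k.+1 x; lia.
have box k x : (x < m k)%N -> exists2 i : 'I_n, i = (f k + x)%N :> nat & D i = k.
  rewrite /m => xm; have lt_n : (f k + x < n)%N by have := f_le k.+1; lia.
  by exists (Ordinal lt_n) => //; apply/diagP => /=; lia.
pose Q k x y := [exists i : 'I_n, [exists j : 'I_n,
  [&& i == f k + x :> nat, j == f k.+1 + y :> nat & e j i]%N]].
have QE k x y (i j : 'I_n) :
    i = (f k + x)%N :> nat -> j = (f k.+1 + y)%N :> nat -> Q k x y = e j i.
  move=> iE jE; apply/existsP/idP => [[i' /existsP[j' /and3P[/eqP i'E /eqP j'E]]]|eji].
    have -> : i' = i by apply: val_inj; rewrite /= i'E iE.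
    by have -> : j' = j by apply: val_inj; rewrite /= j'E jE.
  by exists i; apply/existsP; exists j; rewrite iE jE !eqxx.
pose s k := (m k == 0%N) || (0 < m k.+1)%N && Q k 0%N 0%N.
have inter k := @interlace (Q k) (m k) (m k.+1).
have {inter} inter k : (forall x y, (x < m k)%N -> (y < m k.+1)%N ->
    Q k x y = (y < x + s k)%N) /\ (m k.+1 <= m k + s k <= (m k.+1).+1)%N.
  apply: inter.
  - move=> x y y' /box[i iE Di] ym yy'.
    have [j jE Dj] := box _ _ ym; have [j' j'E Dj'] := box _ _ (leq_ltn_trans yy' ym).
    rewrite (QE k x y i j) // (QE k x y' i j') // => eji.
    have [E|ne] := eqVneq j' j; first by rewrite E.
    have ej'j : e j' j.
      by rewrite e_same ?DE ?Dj ?Dj' // ltn_neqAle val_eqE ne j'E jE leq_add2l.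
    by apply: (e_trans he ej'j eji); rewrite !DE Dj' Di; lia.
  - move=> x x' y x'm /box[j jE Dj] xx'.
    have [i' i'E Di'] := box _ _ x'm; have [i iE Di] := box _ _ (leq_ltn_trans xx' x'm).
    rewrite (QE k x y i j) // (QE k x' y i' j) // => eji.
    have [E|ne] := eqVneq i i'; first by rewrite -E.
    have eii' : e i i'.
      by rewrite e_same ?DE ?Di ?Di' // ltn_neqAle val_eqE ne iE i'E leq_add2l.
    by apply: (e_trans he eji eii'); rewrite !DE Dj Di'; lia.
  - move=> x xm; have [i iE Di] := box _ _ (ltnW xm); have [i' i'E Di'] := box _ _ xm.
    have [||z [dz eiz ezi']] := right i i'.
    + by rewrite e_same ?DE ?Di ?Di' // iE i'E addnS.
    + by rewrite !DE Di Di'.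
    have Dz : D z = k.+1 by move: dz; rewrite !DE Di; lia.
    have /diagP zr := Dz; exists (z - f k.+1)%N.
    rewrite (QE k x _ i z) ?(QE k x.+1 _ i' z) ?subnKC //; try lia.
    by split=> //; [rewrite /m; lia | exact: e_asym].
  - move=> y ym; have [j jE Dj] := box _ _ (ltnW ym); have [j' j'E Dj'] := box _ _ ym.
    have [||z [dz ejz ezj']] := left j j'.
    + by rewrite e_same ?DE ?Dj ?Dj' // jE j'E addnS.
    + by rewrite !DE Dj Dj'.
    have Dz : D z = k by move: dz; rewrite !DE Dj; lia.
    have /diagP zr := Dz; exists (z - f k)%N.
    rewrite (QE k _ y z j) ?(QE k _ y.+1 z j') ?subnKC //; try lia.
    by split=> //; [rewrite /m; lia | exact: e_asym].
pose a k : int := - (\sum_(i < k) s i)%N%:Z.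
have aS k : a k.+1 = a k - (s k : nat)%:Z.
  by rewrite /a big_ord_recr /= PoszD opprD.
pose b k : int := a k + (m k)%:Z.
have a_step k : a k - 1 <= a k.+1 <= a k by rewrite aS; case: (s k); lia.
(* The size bounds of the interlacing are exactly the unit step of the lower boundary [b]. *)
have b_step k : b k - 1 <= b k.+1 <= b k.
  by rewrite /b aS; have [_] := inter k; case: (s k); lia.
pose row x : int := a (D x) + (x - f (D x))%N%:Z.
have rowP x : a (D x) <= row x < b (D x).
  by have /diagP := erefl (D x); rewrite /row /b /m; lia.
have row_onto k r : a k <= r < b k -> exists2 x, D x = k & row x = r.
  rewrite /b => hr; have lt_m : (absz (r - a k) < m k)%N by lia.
  have [x xE Dx] := box _ _ lt_m; exists x => //.
  by rewrite /row Dx xE; lia.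
exists row; split=> [x y dxy xy|x y dyx|].
- have Dxy : D x = D y by move: dxy; rewrite !DE; lia.
  have /diagP := erefl (D x); have /diagP := erefl (D y).
  by rewrite /row Dxy; lia.
- have Dyx : D y = (D x).+1 by move: dyx; rewrite !DE; lia.
  have /diagP xr := erefl (D x); have /diagP yr := Dyx.
  rewrite -(QE (D x) (x - f (D x))%N (y - f (D x).+1)%N x y) ?subnKC //; try lia.
  rewrite (inter (D x)).1; try (rewrite /m; lia).
  by rewrite /row Dyx aS; case: (s (D x)); lia.
- move=> _ [r c] _ [x _ <-] [y _ <-]; rewrite /row_of /col_of /= => hr hc.
  have m0 : m 0%N = 0%N.
    apply/eqP; rewrite -leqn0 leqNgt; apply/negP => /box[i _ Di].
    by have := D_gt0 i; rewrite Di.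
  have a0 : a 0%N = 0 by rewrite /a big_ord0.
  have b0 : b 0%N = 0 by rewrite /b a0 m0.
  have := rowP x; have := rowP y; have := DE x; have := DE y.
  have := unit_step_bounds a_step (leq0n (D x)).
  have := unit_step_bounds b_step (leq0n (D y)).
  rewrite b0 a0 => *.
  (* The diagonal of the new box is at least [M]: [row x] is at least [- D x], and [row y] is
     negative. *)
  have [t tE] : exists t : nat, c - r = M + t%:Z by exists (absz (c - r - M)%R); lia.
  have [z Dz rz] : exists2 z, D z = t & row z = r.
    apply: row_onto.
    (* The upper boundary is compared with [x] and the lower one with [y], on whichever side of them
       [t] falls. *)
    have := @unit_step_bounds a (D x) t a_step; have := @unit_step_bounds a t (D x) a_step.
    have := @unit_step_bounds b (D y) t b_step; have := @unit_step_bounds b t (D y) b_step.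
    by lia.
  by exists z => //; rewrite rz DE Dz; congr pair; lia.
Qed.

(** * The two implications and the equivalence *)

Lemma classical_generalized (R : realType) (n : nat) (gamma : 'rV[R]_n)
    (J : set 'rV[R]_n) :
  placed_shape gamma J ->
  classical_placed_skew_shape gamma J -> generalized_placed_skew_shape gamma J.
Proof.
move=> hshape [la [mu [o [box [hla hmu _ [box_fun _ box_surj] [hd hsame hnw hse]]]]]].
pose d x := diag_of (box x).
have dE x : (d x)%:~R = gamma 0 x by apply: hd.
have dC x : d x = col_of (box x) - row_of (box x) by [].
apply/(generalized_linear_extension dE hshape) => w w_ext x y xy dxy wxy.
have lt_xy : (x < y)%N.
  move: xy; rewrite -val_eqE neq_ltn => /orP[//|yx].
  have := w_ext y x; rewrite box_order_same // => /(_ yx).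
  by rewrite ltnNge ltnW.
have row_xy := hsame _ _ lt_xy dxy.
have diagram_convex := @placed_skew_diagram_convex la mu o hla hmu.
have box_between r c : row_of (box x) <= r <= row_of (box y) ->
    col_of (box x) <= c <= col_of (box y) -> exists z, box z = (r, c).
  move=> hr hc.
  have [z _ zE] := box_surj _ (diagram_convex (box x) (r, c) (box y)
    (box_fun x I) (box_fun y I) hr hc).
  by exists z.
(* As [y] is lower on the same diagonal, the east and south neighbours of [x] lie in the rectangle
   spanned by [x] and [y]. *)
have [z1 z1E] : exists z, box z = (row_of (box x), col_of (box x) + 1).
  by apply: box_between; move: dxy; rewrite !dC; lia.
have [z2 z2E] : exists z, box z = (row_of (box x) + 1, col_of (box x)).
  by apply: box_between; move: dxy; rewrite !dC; lia.
have row_z1 : row_of (box z1) = row_of (box x) by rewrite z1E.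
have row_z2 : row_of (box z2) = row_of (box x) + 1 by rewrite z2E.
have dz1 : d z1 = d x + 1 by rewrite !dC z1E /=; lia.
have dz2 : d x = d z2 + 1 by rewrite !dC z2E /=; lia.
have xz1 : (w x < w z1)%N.
  apply: w_ext; rewrite box_order_up //; apply/negP => /asboolP /hnw [].
  by rewrite row_z1; lia.
have z1y : (w z1 < w y)%N.
  apply: w_ext; rewrite box_order_down; last by rewrite -dxy.
  apply/asboolP; apply: contrapT => nJ.
  have [] := hse y z1 (conj ((PsetP dE y z1).2 _) nJ); first by rewrite -dxy.
  by rewrite row_z1; lia.
have xz2 : (w x < w z2)%N.
  apply: w_ext; rewrite box_order_down //; apply/asboolP; apply: contrapT => nJ.
  have [] := hse z2 x (conj ((PsetP dE z2 x).2 dz2) nJ).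
  by rewrite row_z2; lia.
have z2y : (w z2 < w y)%N.
  apply: w_ext; rewrite box_order_up; last by rewrite -dxy.
  apply/negP => /asboolP /hnw [].
  by rewrite row_z2; lia.
have : w z1 != w z2.
  rewrite (inj_eq perm_inj); apply/eqP => E.
  by move: z1E; rewrite E z2E => -[]; lia.
by rewrite -val_eqE /=; lia.
Qed.

Lemma generalized_classical (R : realType) (n : nat) (gamma : 'rV[R]_n)
    (J : set 'rV[R]_n) :
  placed_shape gamma J -> integral gamma ->
  (forall alpha beta : 'rV[R]_n, J beta -> Zset gamma alpha ->
     pos_roots (beta - alpha) -> J (beta - alpha)) ->
  generalized_placed_skew_shape gamma J -> classical_placed_skew_shape gamma J.
Proof.
move=> hshape hint hJ.
(* Integrality makes the floor exact, which gives the diagonals as integers. *)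
pose d x := Num.floor (gamma 0 x).
have dE x : (d x)%:~R = gamma 0 x by rewrite floorK.
move/(generalized_linear_extension dE hshape) => hw.
have he := box_order_local dE hshape hJ.
have [row [row_same row_next cvx]] := convex_placement he (diag_sorted dE hshape)
  (@box_order_same _ _ J d) (between_right he hw) (between_left he hw).
pose box x := (row x, row x + d x).
have [la [mu [o [hla hmu hsub diagE]]]] := convex_placed_skew_diagram cvx.
have diag_box x : diag_of (box x) = d x by rewrite /diag_of /col_of /row_of /=; lia.
exists la, mu, o, box; split=> //.
  rewrite diagE; split=> [x _|x y _ _ []|_ [x _ <-]]; [by exists x| |by exists x].
  move=> row_xy; rewrite row_xy => /addrI dxy.
  case: (ltngtP x y) => [/row_same|/row_same|/val_inj //].
    by rewrite dxy row_xy ltxx => /(_ erefl).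
  by rewrite dxy row_xy ltxx => /(_ erefl).
split=> [x|x y xy|x y Jxy|x y [/(PsetP dE) dyx nJ]].
- by rewrite diag_box.
- by rewrite !diag_box => /row_same; apply.
- have dyx := J_diag dE hshape Jxy; have := row_next x y dyx.
  rewrite box_order_down // => /esym; rewrite asboolT // => lt_row.
  by rewrite /northwest /row_of /col_of /= dyx; split=> //; lia.
- have := row_next x y dyx; rewrite box_order_down // asboolF // => /esym.
  by rewrite /southeast /row_of /col_of /= dyx => ?; split; lia.
Qed.

Theorem proposition4p2 (R : realType) (n : nat) (gamma : 'rV[R]_n)
    (J : set 'rV[R]_n)
    (hshape : placed_shape gamma J)
    (hint : integral gamma)
    (hJ : forall alpha beta : 'rV[R]_n, J beta -> Zset gamma alpha ->
            pos_roots (beta - alpha) -> J (beta - alpha)) :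
  classical_placed_skew_shape gamma J <-> generalized_placed_skew_shape gamma J.
Proof.
split; first exact: classical_generalized.
exact: generalized_classical.
Qed.
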